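(* Let $X, Y$ be locally convex Hausdorff topological vector spaces, $M: X \to Y$ a continuous linear mapping, $D \subset X$ a generalized polyhedral convex set, and $K=\{ y \in Y \mid \langle y^*_j, y \rangle \leq 0,\ j=1,\dots,q\}$ a polyhedral convex cone, where $y^*_j \in Y^*\setminus\{0\}$ for $j=1,\dots,q$. Let $E$ be the efficient solution set of the problem (VLP) $\min_K\{Mx \mid x \in D\}$. If $K$ is not a linear subspace of $Y$, then $u \in X$ is an efficient solution of (VLP) if and only if there exists $y^* \in \mathrm{ri}\,K^*$ satisfying $u \in \mathrm{argmin}\,(\mathrm{LP})_{y^*}$. In other words, $$E=\bigcup_{y^* \in \mathrm{ri}\,K^*} \mathrm{argmin}\,(\mathrm{LP})_{y^*}.$$
   Context: All vector spaces are real. $X^*$ denotes the (continuous) dual of $X$ and $\langle x^*,x\rangle$ the value of $x^*\in X^*$ at $x\in X$; likewise for $Y$. A subset $C\subset X$ is a generalized polyhedral convex set (generalized convex polyhedron) if there exist $x^*_i\in X^*$, $\alpha_i\in\mathbb R$, $i=1,\dots,p$, and a closed affine subspace $L\subset X$ such that $C=\{x\in X\mid x\in L,\ \langle x^*_i,x\rangle\le\alpha_i,\ i=1,\dots,p\}$. $\ell(K)=K\cap(-K)$. A vector $u\in D$ is an efficient solution of (VLP) if there is no $x\in D$ with $Mu-Mx\in K\setminus\ell(K)$; $E$ is the set of all efficient solutions. For $y^*\in Y^*$, $(\mathrm{LP})_{y^*}$ is the problem $\min\{\langle y^*,Mx\rangle\mid x\in D\}$, and $\mathrm{argmin}\,(\mathrm{LP})_{y^*}$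 is its solution set, i.e. the set of $u\in D$ with $\langle y^*,Mu\rangle\le\langle y^*,Mx\rangle$ for all $x\in D$. $K^*=\{y^*\in Y^*\mid\langle y^*,y\rangle\ge 0\ \forall y\in K\}$ is the positive dual cone. For a convex subset $A$ of a locally convex Hausdorff topological vector space $Z$, the relative interior $\mathrm{ri}\,A$ is the set of points $u$ for which there is a neighborhood $U$ of $u$ in $Z$ with $U\cap\mathrm{cl}(\mathrm{aff}\,A)\subset A$, where $\mathrm{cl}(\mathrm{aff}\,A)$ is the closure of the affine hull of $A$. For $\mathrm{ri}\,K^*$, the space $Y^*$ carries the weak$^*$ topology.
   Formalization: The relative interior ri A is taken as the set of points u belonging to A that have a neighborhood U with U ∩ cl(aff A) ⊂ A; without u ∈ A, points outside cl(aff A) would qualify vacuously and the claim would fail. *)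

(* Defs.v *)
From HB Require Import structures.
From mathcomp Require Import all_boot all_order all_algebra.
From mathcomp Require Import all_classical all_reals all_analysis.

Set Implicit Arguments.
Unset Strict Implicit.
Unset Printing Implicit Defensive.

Import Order.TTheory GRing.Theory Num.Theory.
Import numFieldNormedType.Exports.

Local Open Scope classical_set_scope.
Local Open Scope ring_scope.

Section Dual.
Variables (R : realType) (Y : tvsType R).
Implicit Types f g : Y -> R.

Definition continuous_linear : {pred Y -> R} :=
  mem [set f : Y -> R | linear f /\ continuous f].

Lemma continuous_linear_submod_closed : submod_closed continuous_linear.
Proof.
split=> [|a f g]; rewrite !inE.
  split; last exact: cst_continuous.
  by move=> k x y; rewrite -[RHS]/(k *: 0 + 0 : R) scaler0 addr0.
move=> [lf cf] [lg cg]; split=> [k x y|x].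
  rewrite -[LHS]/(a *: f (k *: x + y) + g (k *: x + y)) lf lg.
  rewrite -[RHS]/(k *: (a *: f x + g x) + (a *: f y + g y)).
  by rewrite !scalerDr !scalerA mulrC addrACA.
by apply: (@cvgD _ R); [apply: cvgZr; exact: cf|exact: cg].
Qed.

HB.instance Definition _ := GRing.isSubmodClosed.Build R (Y -> R)
  continuous_linear continuous_linear_submod_closed.

Record dual : Type := Dual {
  dual_fun :> Y -> R;
  _ : dual_fun \in continuous_linear }.

HB.instance Definition _ := [isSub for dual_fun].
HB.instance Definition _ := [Choice of dual by <:].
HB.instance Definition _ := [SubChoice_isSubLmodule of dual by <:].

(* The weak* topology on the dual is that of pointwise convergence on Y. *)
HB.instance Definition _ := Uniform.copy dual
  (initial_topology (dual_fun : dual -> {ptws Y -> R})).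

Lemma dual_cvgP (F : set_system dual) (f : dual) : Filter F ->
  F --> f <-> forall y, (fun g : dual => g y) @ F --> f y.
Proof.
move=> FF; split=> [Ff y|Ff].
  have := @initial_continuous _ _ (dual_fun : dual -> {ptws Y -> R}) f.
  move/(cvg_comp _ _ Ff).
  by rewrite -/({ptws, dual_fun @ F --> dual_fun f}) => /pointwise_cvgP; apply.
have : {ptws, dual_fun @ F --> dual_fun f} by apply/pointwise_cvgP.
move=> h U [?/= [[W oW <-]]] /= Wf /filterS; apply; apply: h.
exact: open_nbhs_nbhs.
Qed.

Lemma dual_eval_continuous (y : Y) : continuous (fun f : dual => f y).
Proof. by move=> f; have /dual_cvgP := @cvg_id _ (nbhs f); apply. Qed.

Let dual_add_continuous : continuous (fun x : dual * dual => x.1 + x.2).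
Proof.
move=> [f g]; apply/dual_cvgP => y.
suff : (fun x : dual * dual => x.1 y + x.2 y : R) @ (f, g) --> f y + g y by [].
apply: cvgD.
  apply: (@continuous_comp _ _ _ (@fst dual dual) (fun h : dual => h y) (f, g)).
    exact: cvg_fst.
  exact: dual_eval_continuous.
apply: (@continuous_comp _ _ _ (@snd dual dual) (fun h : dual => h y) (f, g)).
  exact: cvg_snd.
exact: dual_eval_continuous.
Qed.

Let dual_scale_continuous : continuous (fun z : R^o * dual => z.1 *: z.2).
Proof.
move=> [k f]; apply/dual_cvgP => y.
suff : (fun z : R^o * dual => z.1 * z.2 y : R) @ (k, f) --> (k * f y : R) by [].
apply: cvgM; first exact: cvg_fst.
apply: (@continuous_comp _ _ _ (@snd R^o dual) (fun h : dual => h y) (k, f)).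
  exact: cvg_snd.
exact: dual_eval_continuous.
Qed.

Let dual_locally_convex :
  exists2 B : set_system dual, (forall b, b \in B -> convex_set b) & basis B.
Proof.
exists [set B | open B /\ convex_set B]; first by move=> b; rewrite inE => -[].
split=> [B []//|f].
have FF : Filter (filter_from
    [set U : set dual | (open U /\ convex_set U) /\ U f] id).
  apply: filter_from_filter.
    by exists setT; split=> //; split; [exact: openT|move=> *; rewrite inE].
  move=> P Q [[oP cP] Pf] [[oQ cQ] Qf]; exists (P `&` Q) => //; split=> //.
  split; first exact: openI.
  move=> x y l; rewrite !in_setI => /andP[xP xQ] /andP[yP yQ].
  by rewrite cP//= cQ.
apply/dual_cvgP => y U Uf.
have [B Bconvex [Bopen Bbase]] := @locally_convex R R.
have [C [BC Cf] CU] := Bbase _ _ Uf.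
exists [set g : dual | C (g y)]; last by move=> g /CU.
split=> //; split.
  apply: (@open_comp _ _ (fun g : dual => g y)); last exact: Bopen.
  by move=> g _; exact: dual_eval_continuous.
move=> g h l; rewrite !inE /= => Cg Ch; apply/set_mem.
by apply: (Bconvex C (mem_set BC) (g y) (h y) l); exact: mem_set.
Qed.

HB.instance Definition _ :=
  PreTopologicalNmodule_isTopologicalNmodule.Build dual dual_add_continuous.
HB.instance Definition _ :=
  TopologicalNmodule_isTopologicalLmodule.Build R dual dual_scale_continuous.
HB.instance Definition _ := Uniform_isTvs.Build R dual dual_locally_convex.
End Dual.

Section ConvexGeometry.
Variable R : realType.

(* The empty set counts as affine; this does not enlarge the class of
   generalized polyhedra, since the constraint 0 <= -1 already yields set0. *)
Definition affine_set (V : lmodType R) (L : set V) : Prop :=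
  forall (x y : V) (t : R), L x -> L y -> L ((1 - t) *: x + t *: y).

Definition affine_hull (V : lmodType R) (A : set V) : set V :=
  smallest (@affine_set V) A.

(* Membership of u in A is required explicitly: for u outside the closed affine
   hull the neighbourhood condition would hold vacuously. *)
Definition relint (Z : tvsType R) (A : set Z) : set Z :=
  [set u | A u /\ exists2 U, nbhs u U & U `&` closure (affine_hull A) `<=` A].

Definition gen_polyhedral_convex (X : tvsType R) (C : set X) : Prop :=
  exists (p : nat) (xstar : 'I_p -> dual X) (alpha : 'I_p -> R) (L : set X),
    [/\ affine_set L, closed L &
        C = [set x | L x /\ forall i, xstar i x <= alpha i]].

Definition polyhedral_cone (Y : tvsType R) (q : nat) (ystar : 'I_q -> dual Y) :
  set Y := [set y | forall j, ystar j y <= 0].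

Definition lineality (Y : lmodType R) (K : set Y) : set Y :=
  K `&` [set - y | y in K].

Definition dual_cone (Y : tvsType R) (K : set Y) : set (dual Y) :=
  [set f | forall y, K y -> 0 <= f y].

Definition efficient (X : Type) (Y : lmodType R) (K : set Y) (M : X -> Y)
    (D : set X) : set X :=
  [set u | D u /\ ~ exists2 x, D x & (K `\` lineality K) (M u - M x)].

Definition argmin (X : Type) (D : set X) (phi : X -> R) : set X :=
  [set u | D u /\ forall x, D x -> phi u <= phi x].

End ConvexGeometry.

(* Main.v *)
Require Import Defs.
From mathcomp Require Import all_boot all_order all_algebra.
From mathcomp Require Import all_classical all_reals all_analysis.
From mathcomp Require Import ring lra.

(** Write K = {y | y*_j(y) <= 0 for all j}. The theorem is a finite-dimensional
    duality statement in disguise: only the finitely many functionals x*_i and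
    y*_j o M matter, so linear algebra over arbitrary real vector spaces is
    enough, and separation theorems do not enter.

    A point y of ri K^* is strictly positive on K \ l(K)
    ([relint_dual_cone_gt0]): if k lies in K but not in l(K), some -y*_j is
    positive at k, and y can be pushed slightly beyond itself, away from -y*_j,
    without leaving K^* ([relint_prolong]). Hence a minimizer over D of y o M
    cannot be improved in the direction of K \ l(K), i.e. it is efficient.

    Conversely, let u be efficient, D = {x in L | x*_i(x) <= alpha_i}. A
    direction d of L along which the constraints active at u do not increase
    is feasible for a short step; efficiency then forbids that all
    y*_j(M d) are nonnegative and one of them is positive
    ([efficient_directions]). Tucker's theorem of the alternative ([tucker])
    turns this into an identity: on the directions of L, a combination
    sum_j lambda_j (y*_j o M) with all lambda_j > 0 equals a nonnegative
    combination of the active x*_i. This says exactly that u minimizes y o M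
    for y = - sum_j lambda_j y*_j. Such a y belongs to ri K^*
    ([relint_dual_cone_pos_comb]): the functionals vanishing on the common
    kernel N of the y*_j form a weak* closed subspace containing K^*, and by
    [dual_system] they have coefficients in the y*_j which are values at fixed
    points of Y, hence weak* continuous, so that a small perturbation inside
    this subspace keeps the coefficients of the right sign.

    Tucker's theorem follows from Farkas' lemma, which is proved by induction
    on the number of inequalities ([farkas_ord]), with no closedness argument
    for finitely generated cones. *)

Set Implicit Arguments.
Unset Strict Implicit.
Unset Printing Implicit Defensive.

Import Order.TTheory GRing.Theory Num.Theory.
Import numFieldNormedType.Exports.

Local Open Scope classical_set_scope.
Local Open Scope ring_scope.

(** * Finite systems of linear inequalities *)

Section LinearInequalities.
Variables (R : realType) (V : lmodType R).

Definition linear_subspace (S : set V) : Prop :=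
  S 0 /\ forall (k : R) (x y : V), S x -> S y -> S (k *: x + y).

Lemma scalar_subZ (f : V -> R) (k : R) (x y : V) :
  scalar f -> f (x - k *: y) = f x - k * f y.
Proof. by move=> lf; rewrite addrC -scaleNr lf mulNr addrC. Qed.

Lemma scalar_zero (f : V -> R) : scalar f -> f 0 = 0.
Proof. by move=> lf; have := lf (-1) 0 0; rewrite scaler0 addr0 mulN1r addNr. Qed.

Lemma scalar_scale (f : V -> R) (k : R) (x : V) :
  scalar f -> f (k *: x) = k * f x.
Proof. by move=> lf; have := lf k x 0; rewrite addr0 scalar_zero// addr0. Qed.

Lemma scalar_sum (f : V -> R) (I : finType) (c : I -> R) (e : I -> V) :
  scalar f -> f (\sum_i c i *: e i) = \sum_i c i * f (e i).
Proof.
move=> lf; apply: (big_ind2 (fun v r => f v = r)) => [|v1 r1 v2 r2 <- <-|i _].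
- exact: scalar_zero.
- by have := lf 1 v1 v2; rewrite scale1r mul1r.
- exact: scalar_scale.
Qed.

(** Farkas' lemma, by Bartl's induction. Either the first inequality is
    redundant, or some z in S violates the conclusion while satisfying all the
    others; then a_0(z) > 0, and projecting along z onto the kernel of a_0
    removes the first inequality. The coefficient of a_0 that this leaves is
    nonnegative because of the signs of the other functionals at z. *)
Lemma farkas_ord n (S : set V) (a : 'I_n -> V -> R) (b : V -> R) :
    linear_subspace S -> (forall i, scalar (a i)) -> scalar b ->
    (forall d, S d -> (forall i, a i d <= 0) -> b d <= 0) ->
  exists2 mu : 'I_n -> R, forall i, 0 <= mu i &
    forall d, S d -> b d = \sum_i mu i * a i d.
Proof.
move=> [S0 SS]; elim: n a b => [|n IHn] a b la lb ab.
  exists (fun=> 0) => // d Sd; rewrite big_ord0; apply/le_anti/andP; split.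
    by apply: ab => // i; case: (notF (ltn_ord i)).
  have := ab (-1 *: d + 0) (SS _ _ _ Sd S0) (fun i => False_ind _ (notF (ltn_ord i))).
  by rewrite lb scalar_zero// addr0 mulN1r oppr_le0.
pose a' i := a (lift ord0 i).
have [useless|/existsNP[z /not_implyP[Sz /not_implyP[az /negP]]]] :=
    pselect (forall d, S d -> (forall i, a' i d <= 0) -> b d <= 0).
  have [mu mu0 bE] := IHn a' b (fun i => la _) lb useless.
  exists (fun i => oapp mu 0 (unlift ord0 i)).
    by move=> i; case: unliftP => [j _|_] /=; [exact: mu0|].
  move=> d Sd; rewrite big_ord_recl unlift_none /= mul0r add0r bE//.
  by apply: eq_bigr => i _; rewrite liftK.
rewrite -ltNge => bz.
have a0z : 0 < a ord0 z.
  rewrite ltNge; apply/negP => a0z; move: bz.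
  apply/negP; rewrite -leNgt; apply: ab => // i.
  by case: (unliftP ord0 i) => [j|] ->; [exact: az|].
pose c d := a ord0 d / a ord0 z.
have lc : scalar c by move=> k x y; rewrite /c la mulrDl mulrA.
(* [proj f] is f composed with the projection onto ker a_0 along z. *)
pose proj (f : V -> R) d := f d - c d * f z.
have lproj f : scalar f -> scalar (proj f).
  by move=> lf k x y; rewrite /proj lf lc; ring.
have projE f d : scalar f -> proj f d = f (d - c d *: z).
  by move=> lf; rewrite scalar_subZ.
have [|//|d Sd|mu mu0 bE] := IHn (fun i => proj (a' i)) (proj b).
- by move=> i; apply: lproj; apply: la.
- exact: lproj.
- move=> ad; rewrite projE//; apply: ab.
    by rewrite addrC -scaleNr; apply: SS.
  move=> i; case: (unliftP ord0 i) => [j|] ->.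
    by rewrite -projE//; apply: ad.
  by rewrite scalar_subZ// /c divfK ?subrr// gt_eqF.
exists (fun i => oapp mu ((b z - \sum_j mu j * a' j z) / a ord0 z) (unlift ord0 i)).
  move=> i; case: unliftP => [j _|_] /=; first exact: mu0.
  rewrite divr_ge0 ?(ltW a0z)// subr_ge0 (le_trans _ (ltW bz))//.
  by apply: sumr_le0 => j _; apply: mulr_ge0_le0.
move=> d Sd; rewrite big_ord_recl unlift_none /=.
under [X in _ = _ + X]eq_bigr do rewrite liftK /= -/(a' _).
have := bE d Sd; rewrite /proj => /eqP; rewrite subr_eq => /eqP ->.
have -> : \sum_i mu i * (a' i d - c d * a' i z) =
    \sum_i mu i * a' i d - c d * \sum_i mu i * a' i z.
  by rewrite mulr_sumr -sumrB; apply: eq_bigr => i _; ring.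
by rewrite /c; ring.
Qed.

Lemma farkas (I : finType) (S : set V) (a : I -> V -> R) (b : V -> R) :
    linear_subspace S -> (forall i, scalar (a i)) -> scalar b ->
    (forall d, S d -> (forall i, a i d <= 0) -> b d <= 0) ->
  exists2 mu : I -> R, forall i, 0 <= mu i &
    forall d, S d -> b d = \sum_i mu i * a i d.
Proof.
move=> hS la lb ab.
have [|d Sd ad|mu mu0 bE] := @farkas_ord #|I| S (fun i => a (enum_val i)) b hS _ lb.
- by move=> i; apply: la.
- by apply: ab => // i; rewrite -(enum_rankK i).
exists (fun i => mu (enum_rank i)) => // d Sd; rewrite bE//.
rewrite [RHS](reindex (@enum_val I I)) /=; last first.
  by exists enum_rank => i _; [exact: enum_valK|exact: enum_rankK].
by apply: eq_bigr => i _; rewrite enum_valK.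
Qed.

(** Each g_j is nonpositive on the cone {a_i <= 0, g_k >= 0}, so by Farkas'
    lemma it is a nonnegative combination of the a_i and the -g_k. Summing these
    identities over j and moving the g_k to the left gives each of them a
    coefficient at least 1. *)
Lemma tucker (I J : finType) (S : set V) (a : I -> V -> R) (g : J -> V -> R) :
    linear_subspace S ->
    (forall i, scalar (a i)) -> (forall j, scalar (g j)) ->
    (forall d, S d -> (forall i, a i d <= 0) -> (forall j, 0 <= g j d) ->
      forall j, g j d <= 0) ->
  exists lambda : J -> R, exists mu : I -> R,
    [/\ forall j, 0 < lambda j, forall i, 0 <= mu i &
        forall d, S d -> \sum_j lambda j * g j d = \sum_i mu i * a i d].
Proof.
move=> hS la lg ag.
pose h (k : I + J) d := match k with inl i => a i d | inr j => - g j d end.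
have lh k : scalar (h k).
  by case: k => [i|j] t x y /=; rewrite ?la// lg; ring.
have H j : exists nu : I + J -> R, (forall k, 0 <= nu k) /\
    forall d, S d -> g j d = \sum_k nu k * h k d.
  have [d Sd hd|nu nu0 gE] := @farkas _ S h (g j) hS lh (lg j); last by exists nu.
  apply: ag => // [i|k]; first exact: (hd (inl i)).
  by rewrite -oppr_le0; exact: (hd (inr k)).
have [nu /all_and2[nu0 gE]] := boolp.choice H.
exists (fun k => 1 + \sum_j nu j (inr k)), (fun i => \sum_j nu j (inl i)); split.
- by move=> j; rewrite ltr_pwDl// sumr_ge0.
- by move=> i; rewrite sumr_ge0.
move=> d Sd.
under eq_bigr do rewrite mulrDl mul1r mulr_suml.
rewrite big_split /= exchange_big /=.
under [RHS]eq_bigr do rewrite mulr_suml.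
rewrite [RHS]exchange_big /= -big_split /=; apply: eq_bigr => j _.
rewrite {1}(gE j d Sd) big_sumType /= -addrA -big_split /=.
by rewrite [X in _ + X]big1 ?addr0// => k _; rewrite mulrN addNr.
Qed.

(** A dual system for possibly dependent functionals: the points e_j span a
    complement of the common kernel, and are 0 for the functionals that depend
    on the later ones. It lets a functional vanishing on the common kernel be
    rebuilt from its values at the e_j. *)
Lemma dual_system n (phi : 'I_n -> V -> R) : (forall i, scalar (phi i)) ->
  exists e : 'I_n -> V, forall y i, phi i (y - \sum_j phi j y *: e j) = 0.
Proof.
elim: n phi => [|n IHn] phi lphi; first by exists (fun=> 0) => y [].
have [e eK] := IHn (fun i => phi (lift ord0 i)) (fun i => lphi _).
(* The residual [r y] is the projection of y onto the kernel of the tail. *)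
pose r y := y - \sum_j phi (lift ord0 j) y *: e j.
have [vanish|] := pselect (forall y, phi ord0 (r y) = 0).
  exists (fun i => oapp e 0 (unlift ord0 i)) => y i.
  rewrite big_ord_recl unlift_none /= scaler0 add0r.
  under eq_bigr do rewrite liftK /=.
  by case: (unliftP ord0 i) => [j|] ->; [exact: eK|exact: vanish].
move=> /existsNP[y0 /eqP r0].
pose z := (phi ord0 (r y0))^-1 *: r y0.
have z0 : phi ord0 z = 1 by rewrite scalar_scale// mulVf.
have zK j : phi (lift ord0 j) z = 0 by rewrite scalar_scale// eK mulr0.
exists (fun i => oapp (fun j => e j - phi ord0 (e j) *: z) z (unlift ord0 i)) => y i.
rewrite big_ord_recl unlift_none /=.
under eq_bigr do rewrite liftK /=.
have -> : y - (phi ord0 y *: z +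
      \sum_(j < n) phi (lift ord0 j) y *: (e j - phi ord0 (e j) *: z))
    = r y - phi ord0 (r y) *: z.
  rewrite /r -[\sum_j _ *: e j in RHS]scale1r scalar_subZ// scalar_sum// mul1r scale1r.
  under eq_bigr do rewrite scalerBr scalerA.
  by rewrite sumrB -scaler_suml scalerBl [in LHS]addrCA [in LHS]opprD addrA.
case: (unliftP ord0 i) => [j|] ->; rewrite scalar_subZ// ?z0 ?mulr1 ?subrr//.
by rewrite zK eK mulr0 subrr.
Qed.

End LinearInequalities.

(** * The relative interior of the dual cone *)

Section Relint.
Variables (R : realType).

(** The prolonged point u + t (u - z) is the affine combination of u and z with
    weights 1 + t and - t, so it stays in the affine hull of A, and for t small
    it lies in the neighborhood of u granted by the relative interior. *)
Lemma relint_prolong (Z : tvsType R) (A : set Z) (u z : Z) :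
  relint A u -> A z -> exists2 t : R, 0 < t & A (u + t *: (u - z)).
Proof.
move=> [Au [U Uu UA]] Az.
have cs : (fun t : R^o => t *: (u - z)) @ (0 : R^o) --> 0 *: (u - z).
  apply: (@continuous2_cvg R^o R^o Z Z (nbhs (0 : R^o)) _ id (fun=> u - z)
    (fun (x : R^o) (y : Z) => x *: y) 0 (u - z)).
  - exact: (@scale_continuous R Z (0, u - z)).
  - exact: cvg_id.
  - exact: cvg_cst.
have cv : (fun t : R^o => u + t *: (u - z)) @ (0 : R^o) --> u.
  rewrite -[X in _ --> X]addr0 -[X in _ --> _ + X](scale0r (u - z)).
  apply: (@continuous2_cvg R^o Z Z Z (nbhs (0 : R^o)) _ (fun=> u)
    (fun t : R^o => t *: (u - z)) (fun x y : Z => x + y) u (0 *: (u - z))) => //.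
  - exact: (@add_continuous Z (u, 0 *: (u - z))).
  - exact: cvg_cst.
have /nbhs_ballP[e /= e0 eU] := cv _ Uu.
exists (e / 2); first by rewrite divr_gt0.
apply: UA; split.
  apply: eU => /=; rewrite /ball/= sub0r normrN gtr0_norm ?divr_gt0//.
  by rewrite ltr_pdivrMr// ltr_pMr// ltr1n.
apply: subset_closure => C [affC AC].
have := affC u z (- (e / 2)) (AC _ Au) (AC _ Az).
by rewrite opprK scalerDl scale1r scaleNr scalerBr addrA.
Qed.

Variables (Y : tvsType R).

Lemma dual_scalar (f : dual Y) : scalar (f : Y -> R).
Proof. by case: f => f /=; rewrite inE => -[]. Qed.

Lemma dual_sub (f : dual Y) (y z : Y) : f (y - z) = f y - f z.
Proof.
by rewrite -[z in LHS]scale1r (scalar_subZ _ _ _ (@dual_scalar f)) mul1r.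
Qed.

Lemma dual_sumE (I : finType) (F : I -> dual Y) (y : Y) :
  (\sum_i F i : dual Y) y = \sum_i F i y.
Proof.
by apply: (big_ind2 (fun (f : dual Y) r => f y = r)) => // f a g b <- <-.
Qed.

Lemma near_dual_eval_lt (f : dual Y) (y : Y) (c : R) :
  f y < c -> \forall g \near f, (g : dual Y) y < c.
Proof. by move=> fc; exact: (cvgr_lt _ (@dual_eval_continuous R Y y f)). Qed.

Lemma closed_annihilator (N : set Y) :
  closed [set f : dual Y | forall y, N y -> f y = 0].
Proof.
have -> : [set f : dual Y | forall y, N y -> f y = 0] =
   \bigcap_(y in N) ((fun f : dual Y => f y) @^-1` [set 0]).
  by [].
apply: (@closed_bigI _ _ N (fun y => (fun f : dual Y => f y) @^-1` [set 0])).
move=> y _; apply: (@preimage_closed _ R); last exact: closed_eq.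
by move=> f _; exact: dual_eval_continuous.
Qed.

Variables (q : nat) (ystar : 'I_q -> dual Y).
Let K := polyhedral_cone ystar.

(** With y*_j(k) < 0, evaluating the point f + t (f - (- y*_j)) of K^* at k gives
    (1 + t) f(k) >= - t y*_j(k) > 0. *)
Lemma relint_dual_cone_gt0 (f : dual Y) (k : Y) :
  relint (dual_cone K) f -> (K `\` lineality K) k -> 0 < f k.
Proof.
move=> rf [Kk nlk].
have [j kj] : exists j, ystar j k < 0.
  apply: contrapT => /forallNP nk; apply: nlk; split=> //.
  exists (- k); last by rewrite opprK.
  move=> j; rewrite -scaleN1r (scalar_scale _ _ (dual_scalar _)) mulN1r oppr_le0.
  by rewrite leNgt; apply/negP; exact: nk.
have Kj : dual_cone K (- ystar j) by move=> y /(_ j); rewrite -oppr_ge0.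
have [t t0 /(_ k Kk)] := relint_prolong rf Kj.
rewrite -[X in 0 <= X]/(f k + t * (f k - - ystar j k)) => h.
have : t * ystar j k < 0 by rewrite pmulr_rlt0.
nra.
Qed.

(** A functional g vanishing on the common kernel N differs from f by
    sum_j (g - f)(e_j) y*_j. The neighborhood g(e_j) < f(e_j) + lambda_j is
    the one on which the resulting coefficients lambda_j - (g - f)(e_j) of the
    functionals -y*_j stay nonnegative. *)
Lemma relint_dual_cone_pos_comb (lambda : 'I_q -> R) :
  (forall j, 0 < lambda j) ->
  relint (dual_cone K) (- \sum_j lambda j *: ystar j).
Proof.
move=> l0; set f := - _.
have combE (c : 'I_q -> R) y :
    (- \sum_j c j *: ystar j : dual Y) y = \sum_j c j * - ystar j y.
  rewrite -[LHS]/(- ((\sum_j c j *: ystar j : dual Y) y)) dual_sumE -sumrN.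
  by apply: eq_bigr => j _; rewrite mulrN.
have comb_ge0 (c : 'I_q -> R) : (forall j, 0 <= c j) ->
    dual_cone K (- \sum_j c j *: ystar j).
  move=> c0 y Ky; rewrite combE; apply: sumr_ge0 => j _.
  by rewrite mulr_ge0// oppr_ge0; apply: Ky.
split; first by apply: comb_ge0 => j; rewrite ltW.
have [e eK] := dual_system (fun j => @dual_scalar (ystar j)).
pose N : set Y := [set y | forall j, ystar j y = 0].
exists [set g : dual Y | forall j, g (e j) < f (e j) + lambda j].
  apply: (@filter_forall (dual Y) _
    (fun j => [set g : dual Y | g (e j) < f (e j) + lambda j]) (nbhs f) _).
  by move=> j; apply: near_dual_eval_lt; rewrite ltrDl.
move=> g [/= gU] clg.
(* Vanishing on N is a weak* closed linear condition satisfied by K^*, hence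
   it passes to the closed affine hull. *)
have gN : forall y, N y -> g y = 0.
  have : closure (affine_hull (dual_cone K)) `<=`
      closure [set h : dual Y | forall y, N y -> h y = 0].
    apply: closure_subset; apply: smallest_sub.
      move=> h1 h2 t h1N h2N y Ny.
      rewrite -[LHS]/((1 - t) * h1 y + t * h2 y).
      by rewrite h1N// h2N// !mulr0 addr0.
    move=> h Kh y Ny; apply/le_anti/andP; split.
      rewrite -oppr_ge0 -mulN1r -(scalar_scale _ _ (@dual_scalar h)).
      apply: Kh => j.
      by rewrite (scalar_scale _ _ (@dual_scalar _)) Ny mulr0.
    by apply: Kh => j; rewrite Ny.
  by rewrite -(proj1 (closure_id _) (@closed_annihilator N)); apply.
have reconstruct (h : dual Y) y : (forall y, N y -> h y = 0) ->
    h y = \sum_j ystar j y * h (e j).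
  move=> hN; have /eqP := hN _ (eK y); rewrite dual_sub subr_eq0 => /eqP ->.
  exact: scalar_sum (@dual_scalar h).
have fN y : N y -> f y = 0.
  by move=> Ny; rewrite combE big1// => j _; rewrite Ny oppr0 mulr0.
move=> k Kk.
have : 0 <= \sum_j (f (e j) + lambda j - g (e j)) * - ystar j k.
  by apply: sumr_ge0 => j _; rewrite mulr_ge0 ?oppr_ge0// subr_ge0 ltW.
under eq_bigr => j _.
  have -> : (f (e j) + lambda j - g (e j)) * - ystar j k =
    (- (ystar j k * f (e j)) + lambda j * - ystar j k) + ystar j k * g (e j) by ring.
  over.
rewrite !big_split /= sumrN -(reconstruct g)// -(reconstruct f)// -combE.
by rewrite -/f addNr add0r.
Qed.

End Relint.

(** * Efficient points and scalarization *)

Section Scalarization.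
Variables (R : realType) (X Y : tvsType R).

(** Along such a direction d, the point u + e d is feasible for small e > 0: the
    constraints inactive at u have some slack. If one of the inequalities
    y*_j(M d) >= 0 were strict, then M u - M (u + e d) = - e M d would lie in K
    but not in l(K). *)
Lemma efficient_directions (M : {linear X -> Y}) (p q : nat)
    (xstar : 'I_p -> dual X) (alpha : 'I_p -> R) (L : set X)
    (ystar : 'I_q -> dual Y) (u : X) :
    affine_set L ->
    efficient (polyhedral_cone ystar) M
      [set x | L x /\ forall i, xstar i x <= alpha i] u ->
  forall d, L (u + d) -> (forall i, xstar i u = alpha i -> xstar i d <= 0) ->
    (forall j, 0 <= ystar j (M d)) -> forall j, ystar j (M d) <= 0.
Proof.
move=> affL [[Lu au] eff] d Ld ad yd j0; rewrite leNgt; apply/negP => yj0.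
apply: eff.
have : \forall e \near (0 : R)^'+, forall i, xstar i u + e * xstar i d <= alpha i.
  apply: filter_forall => i.
  have [ui|ui] := eqVneq (xstar i u) (alpha i).
    near=> e; rewrite -ui gerDl; apply: mulr_ge0_le0; last exact: ad.
    by near: e; exact: nbhs_right_ge.
  have : (fun e : R => xstar i u + e * xstar i d) @ (0 : R)^'+ --> xstar i u.
    rewrite -[X in _ --> X]addr0 -[X in _ --> _ + X](mul0r (xstar i d)).
    apply: cvgD; first exact: cvg_cst.
    by apply: cvgMr_tmp; apply: cvg_at_right_filter; exact: cvg_id.
  move=> /cvgr_le; apply.
  by rewrite lt_neqAle ui au.
move=> /(filterI (nbhs_right_gt 0)) /filter_ex [e [/= e0 ae]].
exists (u + e *: d).
  split=> [|i].
    have := affL u (u + d) e Lu Ld.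
    by rewrite scalerDr addrA -scalerDl subrK scale1r.
  by rewrite addrC (@dual_scalar _ _ (xstar i)) addrC.
have -> : M u - M (u + e *: d) = (- e) *: M d.
  by rewrite linearD linearZ opprD addrA subrr add0r scaleNr.
split=> [j|[_ [z Kz] /(congr1 (ystar j0))]].
  rewrite (scalar_scale _ _ (@dual_scalar _ _ (ystar j))).
  by rewrite mulNr oppr_le0 mulr_ge0// ltW.
rewrite -scaleN1r !(scalar_scale _ _ (@dual_scalar _ _ (ystar j0))).
have := Kz j0; have := mulr_gt0 e0 yj0; rewrite /=; lra.
Unshelve. all: by end_near.
Qed.

Lemma linear_subspace_directions (L : set X) (u : X) :
  affine_set L -> L u -> linear_subspace [set d | L (u + d)].
Proof.
move=> affL Lu; split=> [|k x y /= Lx Ly]; first by rewrite /= addr0.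
(* u + (k x + y) is the midpoint of u + 2 k x and u + 2 y, which lie on lines
   through u. *)
have := affL _ _ 2^-1 (affL u (u + x) (2 * k) Lu Lx) (affL u (u + y) 2 Lu Ly).
congr L.
have slide (t : R) (v : X) : (1 - t) *: u + t *: (u + v) = u + t *: v.
  by rewrite scalerDr addrA -scalerDl subrK scale1r.
have half (v : X) : 2^-1 *: (2 *: v) = v by rewrite scalerA mulVf ?scale1r.
rewrite (_ : 1 - 2^-1 = 2^-1 :> R); last by lra.
rewrite !slide -scalerDr addrACA -mulr2n -(scaler_nat 2 u).
by rewrite -scalerA -scalerDr -scalerDr half.
Qed.

(** Tucker's theorem is applied to the constraints active at u only. At
    x - u, with x feasible, an active constraint takes the value
    x*_i(x) - alpha_i <= 0, so the identity bounds sum_j lambda_j y*_j (M (x - u))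
    from above by 0. *)
Lemma efficient_scalarization (M : {linear X -> Y}) (D : set X) (q : nat)
    (ystar : 'I_q -> dual Y) (u : X) :
    gen_polyhedral_convex D ->
    efficient (polyhedral_cone ystar) M D u ->
  exists2 y : dual Y, relint (dual_cone (polyhedral_cone ystar)) y &
                      argmin D (fun x => y (M x)) u.
Proof.
move=> [p [xstar [alpha [L [affL _ ->]]]]] eff.
have dirs := efficient_directions affL eff.
have [[Lu au] _] := eff.
have [||d Ld ad|] := @tucker R X {i : 'I_p | xstar i u == alpha i} 'I_q _
  (fun i => xstar (val i)) (fun j x => ystar j (M x))
  (linear_subspace_directions affL Lu).
- by move=> i; exact: dual_scalar.
- by move=> j k x y; rewrite linearP dual_scalar.
- apply: dirs => // i /eqP ui.
  exact: ad (exist _ i ui).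
move=> lambda [mu [l0 mu0 combE]].
exists (- \sum_j lambda j *: ystar j); first exact: relint_dual_cone_pos_comb.
split=> // x [Lx ax].
have evalE y : (- \sum_j lambda j *: ystar j : dual Y) y =
    - \sum_j lambda j * ystar j y.
  by rewrite -[LHS]/(- ((\sum_j lambda j *: ystar j : dual Y) y)) dual_sumE.
rewrite !evalE lerN2 -subr_le0 -sumrB.
have /combE : L (u + (x - u)) by rewrite addrC subrK.
under eq_bigr do rewrite linearB dual_sub mulrBr.
move=> ->; apply: sumr_le0 => i _; have /eqP ui := valP i.
by rewrite mulr_ge0_le0// dual_sub subr_le0 ui.
Qed.

End Scalarization.

Theorem theorem3p1 (R : realType) (X Y : tvsType R)
    (hX : hausdorff_space X) (hY : hausdorff_space Y)
    (M : {linear X -> Y}) (hM : continuous M)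
    (D : set X) (hD : gen_polyhedral_convex D)
    (q : nat) (ystar : 'I_q -> dual Y) (hystar : forall j, ystar j != 0)
    (K : set Y) (hK : K = polyhedral_cone ystar)
    (E : set X) (hE : E = efficient K M D)
    (hKnonlin : ~ submod_closed (mem K)) :
  (forall u : X, E u <->
     exists2 y : dual Y, relint (dual_cone K) y &
                         argmin D (fun x => y (M x)) u) /\
  E = \bigcup_(y in relint (dual_cone K)) argmin D (fun x => y (M x)).
Proof.
subst K E.
have iff u : efficient (polyhedral_cone ystar) M D u <->
    exists2 y : dual Y, relint (dual_cone (polyhedral_cone ystar)) y &
                        argmin D (fun x => y (M x)) u.
  split; first exact: efficient_scalarization.
  move=> [y ry [Du minu]]; split=> // -[x Dx better].
  have := relint_dual_cone_gt0 ry better.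
  by have := minu x Dx; rewrite /= dual_sub subr_gt0 ltNge => ->.
split=> //; apply/seteqP; split=> u; first by move=> /iff.
by move=> ?; apply/iff.
Qed.
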